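(* Let $f:\mathbb{R}_+\to\mathbb{R}_+$ be a convex function with $f(1)=0$ that grows at most polynomially, and let $M,L\in\mathcal{L}$. Then $$D_f(L\|M)=D_f(L_\pi\|M_\pi).$$ In particular, if $M\in\mathcal{L}(\pi)$ and $L\in\mathcal{L}$, then $$D_f(L\|M)=D_f(L_\pi\|M),\qquad D_f(M\|L)=D_f(M\|L_\pi).$$
   Context: $\mathcal{X}$ is a finite set and $\pi$ is a fixed probability distribution on $\mathcal{X}$ with $\pi(x)>0$ for all $x$. $\mathcal{L}$ is the set of Markov infinitesimal generators on $\mathcal{X}$, i.e. $\mathcal{X}\times\mathcal{X}$ real matrices with non-negative off-diagonal entries and all row sums zero. $\mathcal{L}(\pi)\subseteq\mathcal{L}$ is the set of $\pi$-reversible generators, i.e. those $M$ with $\pi(x)M(x,y)=\pi(y)M(y,x)$ for all $x,y$. The $\pi$-dual $L_\pi$ of $L\in\mathcal{L}$ is the generator with off-diagonal entries $L_\pi(x,y)=\frac{\pi(y)}{\pi(x)}L(y,x)$, $x\neq y$, and diagonal entries such that all row sums are zero. For $M,L\in\mathcal{L}$ the $f$-divergence is $$D_f(M\|L):=\sum_{x\in\mathcal{X}}\pi(x)\sum_{y\in\mathcal{X}\setminus\{x\}}L(x,y)\,f\!\left(\frac{M(x,y)}{L(x,y)}\right),$$ with the convention $0f(a/0)=0$ for $a\ge 0$. *)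

(* Defs.v *)
From mathcomp Require Import all_boot all_order all_algebra.
From mathcomp Require Import all_classical all_reals all_analysis.

Set Implicit Arguments.
Unset Strict Implicit.
Unset Printing Implicit Defensive.

Import Order.TTheory GRing.Theory Num.Theory.
Import numFieldNormedType.Exports.

Local Open Scope ring_scope.
Local Open Scope classical_set_scope.

Section Generators.
Variables (R : realType) (X : finType).
Implicit Types (p : X -> R) (L M : X -> X -> R).

Definition pos_distribution p : Prop :=
  (forall x, 0 < p x) /\ \sum_x p x = 1.

Definition generator L : Prop :=
  (forall x y, x != y -> 0 <= L x y) /\ (forall x, \sum_y L x y = 0).

Definition reversible_generator p M : Prop :=
  generator M /\ (forall x y, p x * M x y = p y * M y x).

Definition dual p L (x y : X) : R :=
  if x == y then - \sum_(z | z != x) p z / p x * L z x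
  else p y / p x * L y x.

(* The convention 0 f(a/0) = 0 holds automatically: division is total and the
   prefactor L x y vanishes. When M and L are generators, f is only evaluated
   on [0, +oo[. *)
Definition fdiv p (f : R -> R) M L : R :=
  \sum_x p x * \sum_(y | y != x) L x y * f (M x y / L x y).

Definition polynomial_growth (f : R -> R) : Prop :=
  exists (n : nat) (C : R), \forall x \near +oo%R, f x <= C * x ^+ n.

Lemma dual_generator p L :
  pos_distribution p -> generator L -> generator (dual p L).
Proof.
move=> [p_gt0 _] [L_ge0 _]; split=> [x y neq_xy | x].
  rewrite /dual (negPf neq_xy); apply: mulr_ge0.
    by apply: divr_ge0; apply: ltW.
  by apply: L_ge0; rewrite eq_sym.
rewrite (bigD1 x) //= {1}/dual eqxx addrC; apply/eqP; rewrite subr_eq0.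
by apply/eqP/eq_bigr => z neq_zx; rewrite /dual eq_sym (negPf neq_zx).
Qed.

End Generators.

(* Main.v *)
Require Import Defs.
From mathcomp Require Import all_boot all_order all_algebra.
From mathcomp Require Import all_classical all_reals all_analysis.

Import Order.TTheory GRing.Theory Num.Theory.
Import numFieldNormedType.Exports.

Local Open Scope ring_scope.
Local Open Scope classical_set_scope.

(** The divergence is a sum over ordered pairs [(x, y)] of distinct states, and
    its weight is the flow [p x * M x y] from [x] to [y]. Passing to the dual
    reverses the flow: [p x * dual p M x y = p y * M y x] ([dual_flow]). It
    multiplies both [L y x] and [M y x] by the same nonzero factor [p y / p x],
    so the ratio at which [f] is evaluated at [(x, y)] is the original ratio at
    [(y, x)] ([dual_ratio]). Hence the two divergences have the same terms,
    indexed by swapped pairs, and are equal ([fdiv_dual]).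

    In the reversible case [M] and its dual agree off the diagonal
    ([dual_reversible]), which is all that the divergence sees, so [dual p M]
    may be replaced by [M] in either argument. *)

Lemma dual_flow (R : realType) (X : finType) (p : X -> R) (M : X -> X -> R)
    (x y : X) :
  p x != 0 -> y != x -> p x * dual p M x y = p y * M y x.
Proof.
move=> px_neq0 neq_yx.
by rewrite /dual eq_sym (negPf neq_yx) mulrA mulrCA mulfV // mulr1.
Qed.

(** This includes the case [M y x = 0], where both sides are quotients by [0],
    hence [0]. *)
Lemma dual_ratio (R : realType) (X : finType) (p : X -> R) (L M : X -> X -> R)
    (x y : X) :
  p x != 0 -> p y != 0 -> y != x ->
  dual p L x y / dual p M x y = L y x / M y x.
Proof.
move=> px_neq0 py_neq0 neq_yx.
by rewrite /dual eq_sym (negPf neq_yx) -mulf_div divff ?mul1r // mulf_neq0 ?invr_eq0.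
Qed.

Lemma fdiv_dual (R : realType) (X : finType) (p : X -> R) (f : R -> R)
    (L M : X -> X -> R) :
  (forall x, p x != 0) -> fdiv p f L M = fdiv p f (dual p L) (dual p M).
Proof.
move=> p_neq0; rewrite /fdiv.
under eq_bigr do rewrite mulr_sumr.
under [RHS]eq_bigr do rewrite mulr_sumr.
rewrite (exchange_big_dep predT) //=; apply: eq_bigr => x _.
apply: eq_big => [y | y]; first by rewrite eq_sym.
by rewrite eq_sym => neq_yx; rewrite dual_ratio // !mulrA dual_flow.
Qed.

Lemma eq_fdiv (R : realType) (X : finType) (p : X -> R) (f : R -> R)
    (L L' M M' : X -> X -> R) :
  (forall x y, y != x -> L x y = L' x y) ->
  (forall x y, y != x -> M x y = M' x y) ->
  fdiv p f L M = fdiv p f L' M'.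
Proof.
move=> eqL eqM; apply: eq_bigr => x _; congr (_ * _).
by apply: eq_bigr => y neq_yx; rewrite eqL ?eqM.
Qed.

(** By detailed balance the flow of [M] is symmetric, so reversing it changes
    nothing. *)
Lemma dual_reversible (R : realType) (X : finType) (p : X -> R)
    (M : X -> X -> R) (x y : X) :
  p x != 0 -> reversible_generator p M -> y != x -> dual p M x y = M x y.
Proof.
move=> px_neq0 [_ balance] neq_yx; apply: (mulfI px_neq0).
by rewrite dual_flow // balance.
Qed.

Theorem theorem3p1 (R : realType) (X : finType) (p : X -> R)
    (p_distr : pos_distribution p)
    (f : R -> R)
    (f_ge0 : forall x : R, 0 <= x -> 0 <= f x)
    (f_convex : convex_function (`[0, +oo[%classic : set R) f)
    (f1 : f 1 = 0)
    (f_growth : polynomial_growth f) :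
  (forall M L : X -> X -> R, generator M -> generator L ->
     fdiv p f L M = fdiv p f (dual p L) (dual p M)) /\
  (forall M L : X -> X -> R, reversible_generator p M -> generator L ->
     fdiv p f L M = fdiv p f (dual p L) M /\
     fdiv p f M L = fdiv p f M (dual p L)).
Proof.
have p_neq0 x : p x != 0 by rewrite gt_eqF //; case: p_distr.
split=> M L; first by move=> _ _; exact: fdiv_dual.
move=> M_rev _; split; rewrite fdiv_dual //; apply: eq_fdiv => // x y;
  exact: dual_reversible.
Qed.
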